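(* Conditioned on the event $$\Psi=\left\{\ \big\|\,|\Lambda_2|^{1/2}K\,\big\|^2\le 0.5\,|\lambda_k(\Delta_E)|\ \right\},$$ the approximation error $\mathcal{E}=\Delta_E-\Delta_E\Omega(\Omega^T\Delta_E\Omega)^{\dagger}(\Delta_E\Omega)^T$ satisfies $$\mathbb{E}\left[\,\|\mathcal{E}\|\ \middle|\ \Psi\,\right]\le|\lambda_k(\Delta_E)|+2\sqrt{2}\,\big\|\,|\Lambda_2|^{1/2}\big\|\sqrt{|\lambda_k(\Delta_E)|}+2\|\Lambda_2\|.$$
   Context: Let $m\ge p$ be positive integers, $E\in\mathbb{R}^{p\times p}$ symmetric positive definite, $C\in\mathbb{R}^{p\times m}$ of full row rank, $E_D=\mathrm{diag}(E)$ the diagonal part of $E$, and $\Delta_E=C^T(E^{-1}-E_D^{-1})C\in\mathbb{R}^{m\times m}$, a symmetric, possibly indefinite matrix. Let $k<m$ be the sketch size and $\Omega\in\mathbb{R}^{m\times k}$ a standard Gaussian random matrix (independent $N(0,1)$ entries). The randomized algorithm produces the approximation $\widehat{\Delta}_E=\Delta_E\Omega(\Omega^T\Delta_E\Omega)^{\dagger}(\Delta_E\Omega)^T$ of $\Delta_E$, with error $\mathcal{E}=\Delta_E-\widehat{\Delta}_E$; $(\cdot)^\dagger$ is the Moore–Penrose pseudoinverse. Let $\Delta_E=U\Lambda U^T$ be an eigendecomposition with $U=(U_1\ U_2)$ orthogonal, $U_1\in\mathbb{R}^{m\times k}$, and $\Lambda=\mathrm{diag}(\lambda_1(\Delta_E),\dots,\lambda_m(\Delta_E))=\begin{pmatrix}\Lambda_1&0\\0&\Lambda_2\end{pmatrix}$,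 $\Lambda_1\in\mathbb{R}^{k\times k}$, with eigenvalues ordered so that $|\lambda_1(\Delta_E)|\ge\dots\ge|\lambda_m(\Delta_E)|$. Standing assumption: $\lambda_k(\Delta_E)\ne0$. Put $\Omega_1=U_1^T\Omega\in\mathbb{R}^{k\times k}$ (nonsingular almost surely), $\Omega_2=U_2^T\Omega\in\mathbb{R}^{(m-k)\times k}$, and $K=\Omega_2\Omega_1^{-1}$. $|\Lambda_2|^{1/2}$ is the diagonal matrix whose entries are the square roots of the absolute values of the entries of $\Lambda_2$. $\|\cdot\|$ is the spectral norm and $\mathbb{E}[\cdot\,|\,\Psi]$ is conditional expectation given the event $\Psi$. *)

(* Defs.v *)
From HB Require Import structures.
From mathcomp Require Import all_boot all_order all_algebra.
From mathcomp Require Import all_classical all_reals all_analysis.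
Set Implicit Arguments.
Unset Strict Implicit.
Unset Printing Implicit Defensive.
Import Order.TTheory GRing.Theory Num.Theory.
Import numFieldNormedType.Exports.
Local Open Scope classical_set_scope.
Local Open Scope ring_scope.

Definition sym_posdef (R : realType) (n : nat) (A : 'M[R]_n) : Prop :=
  A^T = A /\ forall x : 'cV[R]_n, x != 0 -> 0 < (x^T *m A *m x) 0 0.

Definition diag_part (R : realType) (n : nat) (A : 'M[R]_n) : 'M[R]_n :=
  diag_mx (\row_i A i i).

Definition euclidean_norm (R : realType) (n : nat) (x : 'cV[R]_n) : R :=
  Num.sqrt (\sum_i x i 0 ^+ 2).

(* The norm `|A| that the library puts on matrices is the largest absolute
   value of an entry, so the norm induced by the Euclidean one is needed. *)
Definition spectral_norm (R : realType) (m n : nat) (A : 'M[R]_(m, n)) : R :=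
  sup [set euclidean_norm (A *m x) | x in [set x | euclidean_norm x <= 1]].

Definition is_pseudoinverse (R : realType) (m n : nat)
    (A : 'M[R]_(m, n)) (X : 'M[R]_(n, m)) : Prop :=
  [/\ A *m X *m A = A, X *m A *m X = X,
      (A *m X)^T = A *m X & (X *m A)^T = X *m A].

Definition pseudoinverse (R : realType) (m n : nat) (A : 'M[R]_(m, n)) :
    'M[R]_(n, m) :=
  xget 0 [set X | is_pseudoinverse A X].

Lemma gram_unitmx (R : realType) (r n : nat) (F : 'M[R]_(r, n)) :
  row_free F -> F *m F^T \in unitmx.
Proof.
move=> Ff; rewrite -row_free_unit; apply: inj_row_free => v vFF.
suff vF : v *m F = 0 by apply: (row_free_inj Ff); rewrite vF mul0mx.
have /matrixP/(_ 0 0) : (v *m F) *m (v *m F)^T = 0.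
  by rewrite trmx_mul mulmxA -(mulmxA v) vFF mul0mx.
rewrite mxE [RHS]mxE => /eqP.
under eq_bigr do rewrite [X in _ * X]mxE -expr2.
rewrite psumr_eq0 => [/allP h|i _]; last exact: sqr_ge0.
apply/rowP => i; have := h i (mem_index_enum i).
by rewrite /= sqrf_eq0 => /eqP ->; rewrite mxE.
Qed.

Lemma factored_pseudoinverse (R : realType) (m n r : nat)
    (B : 'M[R]_(m, r)) (F : 'M[R]_(r, n)) :
  F *m F^T \in unitmx -> B^T *m B \in unitmx ->
  is_pseudoinverse (B *m F)
    (F^T *m invmx (F *m F^T) *m invmx (B^T *m B) *m B^T).
Proof.
move=> Fu Bu; set G := invmx (F *m F^T); set H := invmx (B^T *m B).
have Gs : G^T = G by rewrite /G trmx_inv trmx_mul trmxK.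
have Hs : H^T = H by rewrite /H trmx_inv trmx_mul trmxK.
have FG : F *m F^T *m G = 1%:M by exact: mulmxV.
have HB : H *m B^T *m B = 1%:M by rewrite -mulmxA; exact: mulVmx.
have AX : B *m F *m (F^T *m G *m H *m B^T) = B *m H *m B^T.
  by transitivity (B *m (F *m F^T *m G) *m H *m B^T);
    [rewrite !mulmxA | rewrite FG mulmx1].
have XA : F^T *m G *m H *m B^T *m (B *m F) = F^T *m G *m F.
  by transitivity (F^T *m G *m (H *m B^T *m B) *m F);
    [rewrite !mulmxA | rewrite HB mulmx1].
split.
- rewrite AX; transitivity (B *m (H *m B^T *m B) *m F).
    by rewrite !mulmxA.
  by rewrite HB mulmx1.
- rewrite XA; transitivity (F^T *m G *m (F *m F^T *m G) *m H *m B^T).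
    by rewrite !mulmxA.
  by rewrite FG mulmx1.
- by rewrite AX !trmx_mul trmxK Hs mulmxA.
- by rewrite XA !trmx_mul trmxK Gs mulmxA.
Qed.

(* Hence the default value of xget is never taken. *)
Lemma pseudoinverseP (R : realType) (m n : nat) (A : 'M[R]_(m, n)) :
  is_pseudoinverse A (pseudoinverse A).
Proof.
apply: (xgetPex 0 (P := [set X | is_pseudoinverse A X])) => /=.
have Fu := gram_unitmx (row_base_free A).
have Bu : (col_base A)^T *m col_base A \in unitmx.
  rewrite -[X in _ *m X]trmxK; apply: gram_unitmx.
  by rewrite /row_free mxrank_tr; exact: col_base_full.
have := factored_pseudoinverse Fu Bu; rewrite mulmx_base => ?.
by eexists; eassumption.
Qed.

Lemma pseudoinverse_unique (R : realType) (m n : nat) (A : 'M[R]_(m, n))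
    (X : 'M[R]_(n, m)) :
  is_pseudoinverse A X -> pseudoinverse A = X.
Proof.
have [a1 a2 a3 a4] := pseudoinverseP A; set Y := pseudoinverse A in a1 a2 a3 a4 *.
move=> [b1 b2 b3 b4].
have AYX : A *m Y = A *m X.
  by rewrite -a3 -{1}b1 -mulmxA trmx_mul a3 b3 mulmxA a1.
have YAX : Y *m A = X *m A.
  by rewrite -a4 -{1}b1 -!mulmxA mulmxA trmx_mul b4 a4 -mulmxA (mulmxA A) a1.
by rewrite -a2 YAX -mulmxA AYX mulmxA b2.
Qed.

Definition mutually_independent (R : realType) (d : measure_display)
    (T : measurableType d) (P : probability T R) (I : finType)
    (X : I -> {RV P >-> R}) : Prop :=
  forall (J : {set I}) (B : I -> set R), (forall i, measurable (B i)) ->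
    P (\bigcap_(i in [set` J]) X i @^-1` B i)
      = (\prod_(i in J) P (X i @^-1` B i))%E.

Definition standard_gaussian_entries (R : realType) (d : measure_display)
    (T : measurableType d) (P : probability T R) (m k : nat)
    (X : 'I_m -> 'I_k -> {RV P >-> R}) : Prop :=
  (forall i j (B : set R), measurable B ->
     distribution P (X i j) B = normal_prob 0 1 B) /\
  mutually_independent (fun ij : 'I_m * 'I_k => X ij.1 ij.2).

Definition random_matrix (R : realType) (d : measure_display)
    (T : measurableType d) (P : probability T R) (m k : nat)
    (X : 'I_m -> 'I_k -> {RV P >-> R}) (w : T) : 'M[R]_(m, k) :=
  \matrix_(i, j) X i j w.

Definition cond_expectation (R : realType) (d : measure_display)
    (T : measurableType d) (P : probability T R) (A : set T) (X : T -> R) :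
    \bar R :=
  (((fine (P A))^-1)%:E * \int[P]_(w in A) (X w)%:E)%E.

(* Indices are 0-based: lead_ord enumerates 0, .., k-1, trail_ord enumerates
   k, .., m-1, and kth_ord (for k > 0) is k-1, the index of lambda_k. *)
Definition lead_ord (k m : nat) (km : (k < m)%N) : 'I_k -> 'I_m :=
  widen_ord (ltnW km).

Definition trail_ord (k m : nat) (km : (k < m)%N) (j : 'I_(m - k)) : 'I_m :=
  cast_ord (subnKC (ltnW km)) (rshift k j).

Definition kth_ord (k m : nat) (km : (k < m)%N) : 'I_m :=
  Ordinal (leq_ltn_trans (leq_pred k) km).

Definition DeltaE (R : realType) (p m : nat)
    (E : 'M[R]_p) (C : 'M[R]_(p, m)) : 'M[R]_m :=
  C^T *m (invmx E - invmx (diag_part E)) *m C.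

Definition sketch_approx (R : realType) (m k : nat)
    (D : 'M[R]_m) (Om : 'M[R]_(m, k)) : 'M[R]_m :=
  D *m Om *m pseudoinverse (Om^T *m D *m Om) *m (D *m Om)^T.

Definition ordered_eigendecomposition (R : realType) (m : nat)
    (D U : 'M[R]_m) (lam : 'rV[R]_m) : Prop :=
  [/\ U^T *m U = 1%:M, D = U *m diag_mx lam *m U^T &
      forall i j : 'I_m, (i <= j)%N -> `|lam 0 j| <= `|lam 0 i| ].

Definition trailing_diag (R : realType) (k m : nat) (km : (k < m)%N)
    (lam : 'rV[R]_m) : 'M[R]_(m - k) :=
  diag_mx (\row_j lam 0 (trail_ord km j)).

Definition trailing_sqrt_abs (R : realType) (k m : nat) (km : (k < m)%N)
    (lam : 'rV[R]_m) : 'M[R]_(m - k) :=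
  diag_mx (\row_j Num.sqrt `|lam 0 (trail_ord km j)|).

(* K = Omega_2 Omega_1^-1; where Omega_1 = U_1^T Omega is singular, which
   happens with probability 0, invmx returns Omega_1 itself. *)
Definition sketch_ratio (R : realType) (k m : nat) (km : (k < m)%N)
    (U : 'M[R]_m) (Om : 'M[R]_(m, k)) : 'M[R]_(m - k, k) :=
  ((colsub (trail_ord km) U)^T *m Om)
    *m invmx ((colsub (lead_ord km) U)^T *m Om).

(* Main.v *)
(** Write Delta = U1 L1 U1^T + U2 L2 U2^T and Omega_i = U_i^T Omega. When Omega_1
    is nonsingular, the approximation equals W M^-1 W^T with
    W = U1 L1 + U2 L2 K, M = L1 + N and N = K^T L2 K. On the event Psi,
    |N| <= |lambda_k| / 2, so M is invertible with |M^-1| <= 2 / |lambda_k|, and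
    substituting L1 = M - N turns the diagonal block of the error into
    N - N M^-1 N and the off-diagonal one into (1 - N M^-1) K^T L2. Bounding
    the four blocks separately gives the estimate pointwise.

    Omega_1 is almost surely nonsingular because its determinant is an affine
    function of each Gaussian entry: solving for one entry at a time puts the
    singular set inside graphs of functions of the remaining, independent
    entries, and such graphs are null for an atomless law. *)
Require Import Defs.
From HB Require Import structures.
From mathcomp Require Import all_boot all_order all_algebra.
From mathcomp Require Import all_classical all_reals all_analysis.
From mathcomp Require Import measurable_realfun ring lra.
Import Order.TTheory GRing.Theory Num.Theory.
Import numFieldNormedType.Exports.
Local Open Scope classical_set_scope.
Local Open Scope ring_scope.
Set Implicit Arguments.
Unset Strict Implicit.
Unset Printing Implicit Defensive.

(** * Spectral norm *)

Definition dot (R : realType) (n : nat) (x y : 'cV[R]_n) : R := (x^T *m y) 0 0.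

Lemma dotE (R : realType) (n : nat) (x y : 'cV[R]_n) :
  dot x y = \sum_i x i 0 * y i 0.
Proof. by rewrite /dot mxE; apply: eq_bigr => i _; rewrite mxE. Qed.

Lemma dotC (R : realType) (n : nat) (x y : 'cV[R]_n) : dot x y = dot y x.
Proof. by rewrite !dotE; apply: eq_bigr => i _; rewrite mulrC. Qed.

Lemma dotDl (R : realType) (n : nat) (x y z : 'cV[R]_n) :
  dot (x + y) z = dot x z + dot y z.
Proof.
by rewrite !dotE -big_split; apply: eq_bigr => i _; rewrite mxE mulrDl.
Qed.

Lemma dotZl (R : realType) (n : nat) (c : R) (x y : 'cV[R]_n) :
  dot (c *: x) y = c * dot x y.
Proof.
by rewrite !dotE mulr_sumr; apply: eq_bigr => i _; rewrite mxE mulrA.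
Qed.

Lemma dotDr (R : realType) (n : nat) (x y z : 'cV[R]_n) :
  dot x (y + z) = dot x y + dot x z.
Proof. by rewrite dotC dotDl !(dotC x). Qed.

Lemma dotZr (R : realType) (n : nat) (c : R) (x y : 'cV[R]_n) :
  dot x (c *: y) = c * dot x y.
Proof. by rewrite dotC dotZl dotC. Qed.

Lemma dot_mulmx (R : realType) (m n : nat) (A : 'M[R]_(m, n))
    (x : 'cV[R]_m) (y : 'cV[R]_n) : dot x (A *m y) = dot (A^T *m x) y.
Proof. by rewrite /dot trmx_mul trmxK mulmxA. Qed.

Lemma euclidean_norm_ge0 (R : realType) (n : nat) (x : 'cV[R]_n) :
  0 <= euclidean_norm x.
Proof. exact: sqrtr_ge0. Qed.

Lemma sqr_euclidean_norm (R : realType) (n : nat) (x : 'cV[R]_n) :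
  euclidean_norm x ^+ 2 = dot x x.
Proof.
rewrite sqr_sqrtr ?dotE; first by apply: eq_bigr => i _; rewrite expr2.
by apply: sumr_ge0 => i _; exact: sqr_ge0.
Qed.

Lemma euclidean_norm_le (R : realType) (n : nat) (x : 'cV[R]_n) (c : R) :
  0 <= c -> dot x x <= c ^+ 2 -> euclidean_norm x <= c.
Proof.
by move=> c0 h; rewrite -(@ler_pXn2r _ 2) ?nnegrE ?euclidean_norm_ge0 //
  sqr_euclidean_norm.
Qed.

Lemma euclidean_norm_eq0 (R : realType) (n : nat) (x : 'cV[R]_n) :
  euclidean_norm x = 0 -> x = 0.
Proof.
move=> /(congr1 (fun t => t ^+ 2)); rewrite expr0n sqr_euclidean_norm dotE.
move=> /eqP; rewrite psumr_eq0 => [/allP h|i _]; last by rewrite -expr2 sqr_ge0.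
apply/colP => i; have := h i (mem_index_enum i).
by rewrite /= mulf_eq0 orbb => /eqP ->; rewrite mxE.
Qed.

Lemma euclidean_normZ (R : realType) (n : nat) (c : R) (x : 'cV[R]_n) :
  euclidean_norm (c *: x) = `|c| * euclidean_norm x.
Proof.
rewrite /euclidean_norm -sqrtr_sqr -sqrtrM ?sqr_ge0 //; congr Num.sqrt.
by rewrite mulr_sumr; apply: eq_bigr => i _; rewrite mxE exprMn.
Qed.

Lemma euclidean_norm0 (R : realType) (n : nat) :
  euclidean_norm (0 : 'cV[R]_n) = 0.
Proof. by rewrite -(scale0r 0) euclidean_normZ normr0 mul0r. Qed.

Lemma euclidean_normN (R : realType) (n : nat) (x : 'cV[R]_n) :
  euclidean_norm (- x) = euclidean_norm x.
Proof. by rewrite -scaleN1r euclidean_normZ normrN1 mul1r. Qed.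

(** Cauchy-Schwarz. *)
Lemma dot_le (R : realType) (n : nat) (x y : 'cV[R]_n) :
  dot x y <= euclidean_norm x * euclidean_norm y.
Proof.
have [y0|y0] := eqVneq (euclidean_norm y) 0.
  by rewrite y0 (euclidean_norm_eq0 y0) dotC -(scale0r 0) dotZl mul0r mulr0.
have yp : 0 < euclidean_norm y by rewrite lt_def y0 euclidean_norm_ge0.
set a := euclidean_norm x; set c := euclidean_norm y in yp y0 *; set b := dot x y.
(* This vector is [c ^+ 2] times the component of [x] orthogonal to [y]; its squared norm expands to
   [c ^+ 2 * ((a * c) ^+ 2 - b ^+ 2)]. *)
have := sqr_ge0 (euclidean_norm (c ^+ 2 *: x + (- b) *: y)).
rewrite sqr_euclidean_norm !(dotDl, dotDr) !(dotZl, dotZr) (dotC y x).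
rewrite -!sqr_euclidean_norm -/a -/b -/c.
have ac0 : 0 <= a * c by rewrite mulr_ge0 ?euclidean_norm_ge0.
move=> h; have {h} h : b ^+ 2 <= (a * c) ^+ 2.
  have c2 : 0 < c ^+ 2 by rewrite exprn_gt0.
  by rewrite -(ler_pM2l c2); nra.
have [b0|/ltW b0] := leP 0 b; last exact: le_trans ac0.
by rewrite -(@ler_pXn2r _ 2) ?nnegrE.
Qed.

Lemma euclidean_normD (R : realType) (n : nat) (x y : 'cV[R]_n) :
  euclidean_norm (x + y) <= euclidean_norm x + euclidean_norm y.
Proof.
apply: euclidean_norm_le; first by rewrite addr_ge0 ?euclidean_norm_ge0.
rewrite !(dotDl, dotDr) (dotC y x) -!sqr_euclidean_norm.
have := dot_le x y; lra.
Qed.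

(** The constant is the Frobenius norm, by Cauchy-Schwarz on each row. It serves to show that the
    supremum defining [spectral_norm] is finite. *)
Lemma euclidean_norm_mulmx_bound (R : realType) (m n : nat) (A : 'M[R]_(m, n)) :
  exists2 c, 0 <= c & forall x, euclidean_norm (A *m x) <= c * euclidean_norm x.
Proof.
exists (Num.sqrt (\sum_i euclidean_norm (row i A)^T ^+ 2)).
  exact: sqrtr_ge0.
move=> x; apply: euclidean_norm_le.
  by rewrite mulr_ge0 ?sqrtr_ge0 ?euclidean_norm_ge0.
rewrite exprMn sqr_sqrtr; last by apply: sumr_ge0 => i _; exact: sqr_ge0.
rewrite mulr_suml dotE; apply: ler_sum => i _; rewrite -expr2 -exprMn.
have -> : (A *m x) i 0 = dot (row i A)^T x.
  by rewrite /dot trmxK -row_mul [RHS]mxE.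
set a := (row i A)^T.
rewrite -[leLHS]real_normK ?num_real // ler_pXn2r ?nnegrE ?normr_ge0 //; last first.
  by rewrite mulr_ge0 ?euclidean_norm_ge0.
rewrite ler_norml dot_le andbT lerNl.
by have := dot_le (- a) x; rewrite euclidean_normN -scaleN1r dotZl mulN1r.
Qed.

Lemma spectral_norm_has_sup (R : realType) (m n : nat) (A : 'M[R]_(m, n)) :
  has_sup [set euclidean_norm (A *m x) | x in [set x | euclidean_norm x <= 1]].
Proof.
split; first by exists (euclidean_norm (A *m 0)), 0 => //=; rewrite euclidean_norm0.
have [c c0 cA] := euclidean_norm_mulmx_bound A.
exists c => _ [x /= x1 <-]; apply: (le_trans (cA x)).
by rewrite -[leRHS]mulr1 ler_wpM2l.
Qed.

Lemma spectral_norm_ge0 (R : realType) (m n : nat) (A : 'M[R]_(m, n)) :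
  0 <= spectral_norm A.
Proof.
apply: (@le_trans _ _ (euclidean_norm (A *m 0))); first exact: euclidean_norm_ge0.
apply: (sup_upper_bound (spectral_norm_has_sup A)).
by exists 0 => //=; rewrite euclidean_norm0.
Qed.

Lemma euclidean_norm_mulmx (R : realType) (m n : nat) (A : 'M[R]_(m, n))
    (x : 'cV[R]_n) :
  euclidean_norm (A *m x) <= spectral_norm A * euclidean_norm x.
Proof.
have [x0|x0] := eqVneq (euclidean_norm x) 0.
  by rewrite x0 (euclidean_norm_eq0 x0) mulmx0 euclidean_norm0 mulr0.
have xp : 0 < euclidean_norm x by rewrite lt_def x0 euclidean_norm_ge0.
rewrite -ler_pdivrMr //.
apply: (sup_upper_bound (spectral_norm_has_sup A)).
exists ((euclidean_norm x)^-1 *: x) => /=.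
  by rewrite euclidean_normZ gtr0_norm ?invr_gt0 // mulVf.
by rewrite -scalemxAr euclidean_normZ gtr0_norm ?invr_gt0 // mulrC.
Qed.

Lemma spectral_norm_le (R : realType) (m n : nat) (A : 'M[R]_(m, n)) (c : R) :
  0 <= c -> (forall x, euclidean_norm (A *m x) <= c * euclidean_norm x) ->
  spectral_norm A <= c.
Proof.
move=> c0 h; apply: ge_sup; first by case: (spectral_norm_has_sup A).
move=> _ [x /= x1 <-]; apply: (le_trans (h x)).
by rewrite -[leRHS]mulr1 ler_wpM2l.
Qed.

Lemma spectral_normD (R : realType) (m n : nat) (A B : 'M[R]_(m, n)) :
  spectral_norm (A + B) <= spectral_norm A + spectral_norm B.
Proof.
apply: spectral_norm_le => [|x]; first by rewrite addr_ge0 ?spectral_norm_ge0.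
rewrite mulmxDl mulrDl; apply: (le_trans (euclidean_normD _ _)).
by rewrite lerD ?euclidean_norm_mulmx.
Qed.

Lemma spectral_normN (R : realType) (m n : nat) (A : 'M[R]_(m, n)) :
  spectral_norm (- A) = spectral_norm A.
Proof.
rewrite /spectral_norm; congr sup; apply: eq_imagel => x _.
by rewrite mulNmx euclidean_normN.
Qed.

Lemma spectral_normM (R : realType) (m n p : nat) (A : 'M[R]_(m, n))
    (B : 'M[R]_(n, p)) :
  spectral_norm (A *m B) <= spectral_norm A * spectral_norm B.
Proof.
apply: spectral_norm_le => [|x]; first by rewrite mulr_ge0 ?spectral_norm_ge0.
rewrite -mulmxA -mulrA; apply: (le_trans (euclidean_norm_mulmx _ _)).
by rewrite ler_wpM2l ?spectral_norm_ge0 ?euclidean_norm_mulmx.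
Qed.

(** With [y = A^T *m x], the square of the norm of [y] is [dot x (A *m y)], which Cauchy-Schwarz
    bounds by a multiple of the norm of [y]; one factor is then cancelled. *)
Lemma spectral_norm_trmx_le (R : realType) (m n : nat) (A : 'M[R]_(m, n)) :
  spectral_norm A^T <= spectral_norm A.
Proof.
apply: spectral_norm_le => [|x]; first exact: spectral_norm_ge0.
set y := A^T *m x; have [->|y0] := eqVneq (euclidean_norm y) 0.
  by rewrite mulr_ge0 ?spectral_norm_ge0 ?euclidean_norm_ge0.
have yp : 0 < euclidean_norm y by rewrite lt_def y0 euclidean_norm_ge0.
rewrite -(ler_pM2r yp) -expr2 sqr_euclidean_norm -dot_mulmx.
apply: (le_trans (dot_le _ _)); rewrite [leRHS]mulrAC [leRHS]mulrC.
by rewrite ler_wpM2l ?euclidean_norm_ge0 ?euclidean_norm_mulmx.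
Qed.

Lemma spectral_norm_trmx (R : realType) (m n : nat) (A : 'M[R]_(m, n)) :
  spectral_norm A^T = spectral_norm A.
Proof.
by apply/eqP; rewrite eq_le -{3}(trmxK A) !spectral_norm_trmx_le.
Qed.

Lemma spectral_norm_isometry (R : realType) (m n : nat) (A : 'M[R]_(m, n)) :
  A^T *m A = 1%:M -> spectral_norm A <= 1.
Proof.
move=> AA; apply: spectral_norm_le => // x; rewrite mul1r.
apply: euclidean_norm_le; first exact: euclidean_norm_ge0.
by rewrite dot_mulmx mulmxA AA mul1mx sqr_euclidean_norm.
Qed.

Lemma spectral_normD_le (R : realType) (m n : nat) (A B : 'M[R]_(m, n))
    (a b : R) :
  spectral_norm A <= a -> spectral_norm B <= b -> spectral_norm (A + B) <= a + b.
Proof. by move=> Aa Bb; apply: (le_trans (spectral_normD A B)); exact: lerD. Qed.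

Lemma spectral_normB_le (R : realType) (m n : nat) (A B : 'M[R]_(m, n))
    (a b : R) :
  spectral_norm A <= a -> spectral_norm B <= b -> spectral_norm (A - B) <= a + b.
Proof.
by move=> Aa Bb; apply: spectral_normD_le; rewrite ?spectral_normN.
Qed.

Lemma spectral_normM_le (R : realType) (m n p : nat) (A : 'M[R]_(m, n))
    (B : 'M[R]_(n, p)) (a b : R) :
  spectral_norm A <= a -> spectral_norm B <= b -> spectral_norm (A *m B) <= a * b.
Proof.
move=> Aa Bb; apply: (le_trans (spectral_normM A B)).
by rewrite ler_pM ?spectral_norm_ge0.
Qed.

Lemma spectral_norm1 (R : realType) (n : nat) :
  spectral_norm (1%:M : 'M[R]_n) <= 1.
Proof. by apply: spectral_norm_isometry; rewrite trmx1 mulmx1. Qed.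

(** Each block of the error has this shape, with orthonormal eigenvectors on both sides, so only the
    inner matrix has to be estimated. *)
Lemma spectral_norm_sandwich_isometry (R : realType) (m k r : nat)
    (V : 'M[R]_(m, k)) (W : 'M[R]_(m, r)) (A : 'M[R]_(k, r)) (a : R) :
  V^T *m V = 1%:M -> W^T *m W = 1%:M ->
  spectral_norm A <= a -> spectral_norm (V *m A *m W^T) <= a.
Proof.
move=> VV WW Aa; rewrite -[a]mul1r -[1 * a]mulr1.
apply: spectral_normM_le; first apply: spectral_normM_le => //.
  exact: spectral_norm_isometry.
by rewrite spectral_norm_trmx; exact: spectral_norm_isometry.
Qed.

(** * Deterministic error bound *)

Lemma pseudoinverse_unitmx (R : realType) (n : nat) (A : 'M[R]_n) :
  A \in unitmx -> pseudoinverse A = invmx A.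
Proof.
move=> Au; apply: pseudoinverse_unique.
by split; rewrite ?mulmxV ?mulVmx ?mul1mx ?trmx1.
Qed.

(** A lower bound on the norm of [A *m x] makes the kernel trivial, which suffices for a square
    matrix. *)
Lemma coercive_unitmx (R : realType) (n : nat) (A : 'M[R]_n) (c : R) :
  0 < c -> (forall x, c * euclidean_norm x <= euclidean_norm (A *m x)) ->
  A \in unitmx.
Proof.
move=> c0 cA; rewrite -unitmx_tr -row_free_unit; apply: inj_row_free => v vA.
have Av : A *m v^T = 0 by rewrite -[A]trmxK -trmx_mul vA trmx0.
apply: trmx_inj; rewrite trmx0; apply: euclidean_norm_eq0.
apply/eqP; rewrite eq_le euclidean_norm_ge0 andbT -(ler_pM2l c0) mulr0.
by rewrite -[leRHS](euclidean_norm0 R n) -Av.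
Qed.

Lemma spectral_norm_invmx (R : realType) (n : nat) (A : 'M[R]_n) (c : R) :
  0 < c -> (forall x, c * euclidean_norm x <= euclidean_norm (A *m x)) ->
  spectral_norm (invmx A) <= c^-1.
Proof.
move=> c0 cA; have Au := coercive_unitmx c0 cA.
apply: spectral_norm_le => [|x]; first by rewrite invr_ge0 ltW.
by rewrite -ler_pdivrMl ?invr_gt0 // invrK -{2}[x](mulKVmx Au) cA.
Qed.

(** The core matrix is invertible, so its pseudoinverse is the inverse of [Z^T *m M *m Z], and the
    outer factors [Z] and [Z^T] cancel. *)
Lemma sketch_approx_factored (R : realType) (m k : nat) (D : 'M[R]_m)
    (Om W : 'M[R]_(m, k)) (Z M : 'M[R]_k) :
  Z \in unitmx -> M \in unitmx -> D *m Om = W *m Z ->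
  Om^T *m D *m Om = Z^T *m M *m Z ->
  sketch_approx D Om = W *m invmx M *m W^T.
Proof.
move=> Zu Mu DOm OmDOm; have ZTu : Z^T \in unitmx by rewrite unitmx_tr.
have Au : Z^T *m M *m Z \in unitmx by rewrite !unitmx_mul ZTu Mu Zu.
rewrite /sketch_approx OmDOm pseudoinverse_unitmx // DOm trmx_mul.
(* Checked after multiplying on the left by [M] and then by [Z^T], which exposes the core next to
   its own inverse. *)
suff -> : invmx M = Z *m invmx (Z^T *m M *m Z) *m Z^T by rewrite !mulmxA.
apply: (can_inj (mulKmx Mu)); rewrite mulmxV //.
apply: (can_inj (mulKmx ZTu)); rewrite mulmx1 !mulmxA.
by rewrite mulmxV // mul1mx.
Qed.

(** [S] stands for the root of the absolute trailing eigenvalues and [J] for their signs.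
    Indefiniteness enters only through [J], a contraction, so the estimates are those of the
    semidefinite case. *)
Lemma sketch_error_bound (R : realType) (m k r : nat)
    (U1 : 'M[R]_(m, k)) (U2 : 'M[R]_(m, r)) (L1 : 'M[R]_k) (S J : 'M[R]_r)
    (Om : 'M[R]_(m, k)) (l : R) :
  let K := U2^T *m Om *m invmx (U1^T *m Om) in
  let L2 := S *m J *m S in
  let D := U1 *m L1 *m U1^T + U2 *m L2 *m U2^T in
  U1^T *m U1 = 1%:M -> U2^T *m U2 = 1%:M ->
  L1^T = L1 -> S^T = S -> J^T = J -> spectral_norm J <= 1 ->
  U1^T *m Om \in unitmx -> 0 < l ->
  (forall x, l * euclidean_norm x <= euclidean_norm (L1 *m x)) ->
  spectral_norm (S *m K) ^+ 2 <= 2^-1 * l ->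
  spectral_norm (D - sketch_approx D Om) <=
    l + 2 * Num.sqrt 2 * spectral_norm S * Num.sqrt l
      + (spectral_norm L2 + spectral_norm S ^+ 2).
Proof.
move=> K L2 D U1U1 U2U2 L1s Ss Js J1 Zu l0 L1l SKl.
set Z := U1^T *m Om in K SKl Zu *.
have KZ : K *m Z = U2^T *m Om by rewrite /K mulmxKV.
clearbody K.
pose N := K^T *m L2 *m K; pose M := L1 + N.
have L2s : L2^T = L2 by rewrite /L2 !trmx_mul Ss Js mulmxA.
have L2E : L2 = S *m J *m S by [].
clearbody L2.
have Ns : N^T = N by rewrite /N !trmx_mul trmxK L2s mulmxA.
have hl0 : 0 < 2^-1 * l by rewrite mulr_gt0 ?invr_gt0.
have sl : Num.sqrt (2^-1 * l) ^+ 2 = 2^-1 * l by rewrite sqr_sqrtr // ltW.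
have SK : spectral_norm (S *m K) <= Num.sqrt (2^-1 * l).
  rewrite -(@ler_pXn2r _ 2) ?nnegrE ?spectral_norm_ge0 ?sqrtr_ge0 //.
  by rewrite sl.
have KSE : K^T *m S = (S *m K)^T by rewrite trmx_mul Ss.
have KS : spectral_norm (K^T *m S) <= Num.sqrt (2^-1 * l).
  by rewrite KSE spectral_norm_trmx.
(* [N] is the transpose of [S *m K], times [J], times [S *m K]; the event bounds each outer factor
   by the root of [2^-1 * l]. *)
have Nl : spectral_norm N <= 2^-1 * l.
  have -> : N = K^T *m S *m J *m (S *m K) by rewrite /N L2E !mulmxA.
  rewrite -[leRHS]sl expr2.
  apply: spectral_normM_le => //; rewrite -[Num.sqrt _]mulr1.
  exact: spectral_normM_le.
(* Since [L1 = M - N], the perturbation [N] consumes at most half of the lower bound [l] for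
   [L1]. *)
have Ml x : 2^-1 * l * euclidean_norm x <= euclidean_norm (M *m x).
  have := euclidean_normD (M *m x) (- (N *m x)).
  rewrite -mulNmx -mulmxDl /M addrK mulNmx euclidean_normN.
  have := L1l x; have := euclidean_norm_mulmx N x.
  have := ler_wpM2r (euclidean_norm_ge0 x) Nl; lra.
have Mu := coercive_unitmx hl0 Ml.
have Mil := spectral_norm_invmx hl0 Ml; set Mi := invmx M in Mil.
have DOm : D *m Om = (U1 *m L1 + U2 *m L2 *m K) *m Z.
  by rewrite /D !mulmxDl -!mulmxA KZ.
have OmDOm : Om^T *m D *m Om = Z^T *m M *m Z.
  rewrite -mulmxA DOm /M /N.
  rewrite !(mulmxDl, mulmxDr) !mulmxA; congr (_ + _).
    by rewrite /Z trmx_mul trmxK.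
  by rewrite -(trmx_mul K) KZ trmx_mul trmxK.
rewrite (sketch_approx_factored Zu Mu DOm OmDOm) -/Mi.
have MM : Mi *m M = 1%:M by rewrite mulVmx.
have MM' : M *m Mi = 1%:M by rewrite mulmxV.
have L1E : L1 = M - N by rewrite /M addrK.
have Mis : Mi^T = Mi by rewrite /Mi trmx_inv /M linearD /= L1s Ns.
have L1Mi : L1 *m Mi = 1%:M - N *m Mi by rewrite L1E mulmxBl MM'.
have MiL1 : Mi *m L1 = 1%:M - Mi *m N by rewrite L1E mulmxBr MM.
have B11 : L1 - L1 *m Mi *m L1 = N - N *m Mi *m N.
  rewrite L1Mi mulmxBl mul1mx subKr -(mulmxA N Mi L1) MiL1 mulmxBr mulmx1.
  by rewrite mulmxA.
pose B12 := L1 *m Mi *m K^T *m L2.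
have B21 : L2 *m K *m Mi *m L1 = B12^T.
  by rewrite /B12 !trmx_mul L2s trmxK Mis L1s !mulmxA.
(* The error in four blocks; the two off-diagonal ones are transposes of each other. *)
have -> : D - (U1 *m L1 + U2 *m L2 *m K) *m Mi *m (U1 *m L1 + U2 *m L2 *m K)^T
  = U1 *m (N - N *m Mi *m N) *m U1^T
    - (U1 *m B12 *m U2^T + U2 *m B12^T *m U1^T)
    + U2 *m (L2 - L2 *m K *m Mi *m K^T *m L2) *m U2^T.
  rewrite -B11 -B21 /D /B12 linearD /= !trmx_mul L1s L2s.
  rewrite !(mulmxBl, mulmxBr, mulmxDl, mulmxDr) !mulmxA !opprD.
  rewrite mulmxN mulNmx !mulmxA -!addrA; congr (_ + _).
  by do 3 (rewrite [LHS]addrCA; congr (_ + _)).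
have hlV : 2^-1 * l * (2^-1 * l)^-1 = 1 by rewrite mulfV // gt_eqF.
(* The factor 2 bounds the norm of [1%:M - N *m Mi]: the product [N *m Mi] has norm at most
   [2^-1 * l] times its inverse, that is 1. *)
have n12 : spectral_norm B12 <= 2 * Num.sqrt (2^-1 * l) * spectral_norm S.
  have -> : B12 = (1%:M - N *m Mi) *m (K^T *m S *m J) *m S.
    by rewrite -L1Mi /B12 L2E !mulmxA.
  apply: spectral_normM_le => //; apply: spectral_normM_le.
    rewrite -[2]/(1 + 1); apply: spectral_normB_le; first exact: spectral_norm1.
    by rewrite -hlV; exact: spectral_normM_le.
  by rewrite -[Num.sqrt _]mulr1; exact: spectral_normM_le.
(* The two off-diagonal blocks contribute this coefficient once each, whence [2 * Num.sqrt 2] in the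
   bound. *)
have s2 : 2 * Num.sqrt (2^-1 * l) = Num.sqrt 2 * Num.sqrt l.
  rewrite sqrtrM ?invr_ge0 // sqrtrV // mulrA; congr (_ * _).
  by rewrite -{1}[2]sqr_sqrtr // expr2 mulfK // sqrtr_eq0 -ltNge.
apply: spectral_normD_le; first apply: spectral_normB_le.
- apply: spectral_norm_sandwich_isometry => //.
  (* One summand for [N] and one for [N *m Mi *m N]. *)
  have -> : l = 2^-1 * l + 2^-1 * l * (2^-1 * l)^-1 * (2^-1 * l).
    by rewrite hlV; lra.
  apply: spectral_normB_le => //; apply: spectral_normM_le => //.
  exact: spectral_normM_le.
- have -> : 2 * Num.sqrt 2 * spectral_norm S * Num.sqrt l =
    2 * Num.sqrt (2^-1 * l) * spectral_norm S
    + 2 * Num.sqrt (2^-1 * l) * spectral_norm S by rewrite s2; ring.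
  apply: spectral_normD_le; apply: spectral_norm_sandwich_isometry => //.
  by rewrite spectral_norm_trmx.
- apply: spectral_norm_sandwich_isometry => //; apply: spectral_normB_le => //.
  have -> : L2 *m K *m Mi *m K^T *m L2 =
      S *m J *m (S *m K) *m Mi *m (K^T *m S) *m J *m S.
    by rewrite L2E !mulmxA.
  (* One scalar for each of the seven matrix factors; the two roots cancel against the bound for
     [Mi]. *)
  have -> : spectral_norm S ^+ 2 = spectral_norm S * 1 * Num.sqrt (2^-1 * l)
      * (2^-1 * l)^-1 * Num.sqrt (2^-1 * l) * 1 * spectral_norm S.
    transitivity (spectral_norm S * (Num.sqrt (2^-1 * l) ^+ 2
      * (2^-1 * l)^-1) * spectral_norm S); last by rewrite !mulr1; ring.
    by rewrite sl hlV mulr1 expr2.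
  by do 6 (apply: spectral_normM_le; last by []); exact: lexx.
Qed.

(** * Diagonal matrices and the splitting of the spectrum *)

Lemma euclidean_norm_diag_ge (R : realType) (n : nat) (v : 'rV[R]_n) (c : R)
    (x : 'cV[R]_n) :
  0 <= c -> (forall i, c <= `|v 0 i|) ->
  c * euclidean_norm x <= euclidean_norm (diag_mx v *m x).
Proof.
move=> c0 cv; rewrite -(@ler_pXn2r _ 2) ?nnegrE ?mulr_ge0 ?euclidean_norm_ge0 //.
rewrite exprMn !sqr_euclidean_norm !dotE mulr_sumr mul_diag_mx.
apply: ler_sum => i _; rewrite !mxE -!expr2 exprMn ler_wpM2r ?sqr_ge0 //.
by rewrite -[leRHS]real_normK ?num_real // ler_pXn2r ?nnegrE.
Qed.

Lemma spectral_norm_diag_le (R : realType) (n : nat) (v : 'rV[R]_n) (c : R) :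
  0 <= c -> (forall i, `|v 0 i| <= c) -> spectral_norm (diag_mx v) <= c.
Proof.
move=> c0 vc; apply: spectral_norm_le => // x.
rewrite -(@ler_pXn2r _ 2) ?nnegrE ?mulr_ge0 ?euclidean_norm_ge0 //.
rewrite exprMn !sqr_euclidean_norm !dotE mulr_sumr mul_diag_mx.
apply: ler_sum => i _; rewrite !mxE -!expr2 exprMn ler_wpM2r ?sqr_ge0 //.
by rewrite -[leLHS]real_normK ?num_real // ler_pXn2r ?nnegrE.
Qed.

(** Apply the matrix to the [i]-th standard basis vector, which has norm 1. *)
Lemma diag_entry_le_spectral_norm (R : realType) (n : nat) (v : 'rV[R]_n) i :
  `|v 0 i| <= spectral_norm (diag_mx v).
Proof.
have e1 : euclidean_norm (delta_mx i 0 : 'cV[R]_n) = 1.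
  rewrite /euclidean_norm (bigD1 i) //= big1 ?addr0 => [|j /negPf ji].
    by rewrite mxE !eqxx expr1n sqrtr1.
  by rewrite mxE ji expr0n.
rewrite -[leLHS]mulr1 -[leRHS]mulr1 -e1 -euclidean_normZ.
have -> : v 0 i *: delta_mx i 0 = diag_mx v *m delta_mx i 0 :> 'cV_n.
  apply/matrixP => j l; rewrite mul_diag_mx !mxE.
  by case: eqP => [->|]//=; rewrite !mulr0.
exact: euclidean_norm_mulmx.
Qed.

Lemma spectral_norm_sqrt_diag (R : realType) (n : nat) (v : 'rV[R]_n) :
  spectral_norm (diag_mx (\row_i Num.sqrt `|v 0 i|)) ^+ 2
    <= spectral_norm (diag_mx v).
Proof.
have nv := spectral_norm_ge0 (diag_mx v).
rewrite -[leRHS]sqr_sqrtr // ler_pXn2r ?nnegrE ?spectral_norm_ge0 ?sqrtr_ge0 //.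
apply: spectral_norm_diag_le => [|i]; first exact: sqrtr_ge0.
rewrite mxE ger0_norm ?sqrtr_ge0 // ler_sqrt //.
exact: diag_entry_le_spectral_norm.
Qed.

Lemma lead_ordE (k m : nat) (km : (k < m)%N) (i : 'I_k) :
  lead_ord km i = cast_ord (subnKC (ltnW km)) (lshift (m - k) i).
Proof. exact: val_inj. Qed.

Lemma big_lead_trail (R : nmodType) (k m : nat) (km : (k < m)%N)
    (F : 'I_m -> R) :
  \sum_i F i = \sum_i F (lead_ord km i) + \sum_j F (trail_ord km j).
Proof.
have e := subnKC (ltnW km); rewrite (reindex (cast_ord e)); last first.
  by exists (cast_ord (esym e)) => i _; rewrite ?cast_ordK ?cast_ordKV.
rewrite big_split_ord; congr (_ + _); apply: eq_bigr => i _; congr F.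
  by rewrite lead_ordE; exact: val_inj.
exact: val_inj.
Qed.

Lemma colsub_isometry (R : realType) (m n : nat) (U : 'M[R]_m)
    (f : 'I_n -> 'I_m) :
  injective f -> U^T *m U = 1%:M -> (colsub f U)^T *m colsub f U = 1%:M.
Proof.
move=> fi /matrixP UU; apply/matrixP => i j.
have := UU (f i) (f j); rewrite !mxE (inj_eq fi) => <-.
by apply: eq_bigr => l _; rewrite !mxE.
Qed.

Lemma lead_ord_inj (k m : nat) (km : (k < m)%N) : injective (lead_ord km).
Proof. by move=> i j /(congr1 val) /= /val_inj. Qed.

Lemma trail_ord_inj (k m : nat) (km : (k < m)%N) : injective (trail_ord km).
Proof. by move=> i j /cast_ord_inj/rshift_inj. Qed.

Lemma eigendecomposition_split (R : realType) (k m : nat) (km : (k < m)%N)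
    (U : 'M[R]_m) (lam : 'rV[R]_m) :
  U *m diag_mx lam *m U^T =
    colsub (lead_ord km) U *m diag_mx (\row_j lam 0 (lead_ord km j))
      *m (colsub (lead_ord km) U)^T
    + colsub (trail_ord km) U *m trailing_diag km lam
      *m (colsub (trail_ord km) U)^T.
Proof.
apply/matrixP => i j; rewrite !mul_mx_diag !mxE (big_lead_trail km).
by congr (_ + _); apply: eq_bigr => l _; rewrite !mxE.
Qed.

(** Every real is its sign times its absolute value; this supplies the factors [S], [J], [S] of
    [sketch_error_bound]. *)
Lemma trailing_diag_factor (R : realType) (k m : nat) (km : (k < m)%N)
    (lam : 'rV[R]_m) :
  trailing_diag km lam = trailing_sqrt_abs km lam
    *m diag_mx (\row_j Num.sg (lam 0 (trail_ord km j)))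
    *m trailing_sqrt_abs km lam.
Proof.
rewrite /trailing_diag /trailing_sqrt_abs !mulmx_diag; congr diag_mx.
apply/rowP => j; rewrite !mxE mulrAC -expr2 sqr_sqrtr ?normr_ge0 //.
by rewrite mulrC -numEsg.
Qed.

Lemma conditional_error_bound (R : realType) (k m : nat) (km : (k < m)%N)
    (D U : 'M[R]_m) (lam : 'rV[R]_m) (Om : 'M[R]_(m, k)) :
  let l := `|lam 0 (kth_ord km)| in
  ordered_eigendecomposition D U lam -> lam 0 (kth_ord km) != 0 ->
  (colsub (lead_ord km) U)^T *m Om \in unitmx ->
  spectral_norm (trailing_sqrt_abs km lam *m sketch_ratio km U Om) ^+ 2
    <= 2^-1 * l ->
  spectral_norm (D - sketch_approx D Om) <=
    l + 2 * Num.sqrt 2 * spectral_norm (trailing_sqrt_abs km lam) * Num.sqrt l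
      + 2 * spectral_norm (trailing_diag km lam).
Proof.
move=> l [UU -> lam_sorted] l_neq0 Zu Psi.
have l0 : 0 < l by rewrite normr_gt0.
pose J := diag_mx (\row_j Num.sg (lam 0 (trail_ord km j))).
have J1 : spectral_norm J <= 1.
  by apply: spectral_norm_diag_le => // i; rewrite mxE normr_sg; case: eqP.
pose L1 := diag_mx (\row_j lam 0 (lead_ord km j)).
have L1l x : l * euclidean_norm x <= euclidean_norm (L1 *m x).
  apply: euclidean_norm_diag_ge => [|i]; rewrite ?mxE ?(ltW l0) //.
  (* The index of [kth_ord] is [k.-1]; the existence of [i] in ['I_k] gives [0 < k], so this is the
     last leading index. *)
  apply: lam_sorted => /=.
  by rewrite -ltnS prednK // (leq_ltn_trans _ (ltn_ord i)).
have := sketch_error_bound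
  (colsub_isometry (@lead_ord_inj _ _ km) UU)
  (colsub_isometry (@trail_ord_inj _ _ km) UU)
  (tr_diag_mx _) (tr_diag_mx _) (tr_diag_mx _) J1 Zu l0 L1l Psi.
rewrite -/(trailing_sqrt_abs km lam) -trailing_diag_factor.
rewrite -eigendecomposition_split => /le_trans; apply.
(* It remains to absorb the squared norm of the root of the trailing block into a second copy of the
   norm of that block. *)
rewrite lerD2l mulr_natl mulr2n lerD2l.
have -> : trailing_sqrt_abs km lam = diag_mx (\row_j Num.sqrt
    `|(\row_j lam 0 (trail_ord km j)) 0 j|).
  by congr diag_mx; apply/rowP => j; rewrite !mxE.
exact: spectral_norm_sqrt_diag.
Qed.

(** * Null sets of functions affine in each independent coordinate *)

(** Independence makes the joint law the product of the marginals, as the two agree on rectangles;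
    the product measure of [D] is then the integral of the null sections. *)
Lemma independent_graph_null (R : realType) (d d' : measure_display)
    (T : measurableType d) (T' : measurableType d') (P : probability T R)
    (Y : {mfun T >-> T'}) (X : {RV P >-> R}) (D : set (T' * R)) :
  (forall A B, measurable A -> measurable B ->
    P (Y @^-1` A `&` X @^-1` B) = P (Y @^-1` A) * P (X @^-1` B))%E ->
  measurable D -> (forall y, P (X @^-1` xsection D y) = 0) ->
  P ((fun w => (Y w, X w)) @^-1` D) = 0.
Proof.
move=> indep mD D0.
have mYX : measurable_fun [set: T] (fun w => (Y w, X w)).
  exact: measurable_fun_pair.
pose YX : {mfun T >-> (T' * R)%type} := mfun_Sub (mem_set mYX).
have prodE : (distribution P Y \x distribution P X)%E D = distribution P YX D.
  by apply: product_measure_unique => // A B mA mB; rewrite -[LHS]indep.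
rewrite -[LHS]/(distribution P YX D) -prodE.
rewrite /product_measure1 integral0_eq // => y _ /=.
exact: D0.
Qed.

(** A pi-lambda argument: both sides are finite measures in [E], and they agree on the cylinders
    over the coordinates other than [i], which are stable under intersection and generate the
    sigma-algebra. *)
Lemma mutually_independent_system (R : realType) (d : measure_display)
    (T : measurableType d) (P : probability T R) (I : finType)
    (X : I -> {RV P >-> R}) (i : I) (A : set R) (E : set T) :
  mutually_independent X -> measurable A ->
  <<s [set \bigcap_(j in [set` [set~ i]%SET]) X j @^-1` B j
      | B in [set B | forall j, measurable (B j)]] >> E ->
  P (E `&` X i @^-1` A) = (P E * P (X i @^-1` A))%E.
Proof.
move=> indep mA.
set G := (X in <<s X >>) => GE.
have mX j (B : set R) : measurable B -> measurable (X j @^-1` B).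
  by move=> mB; rewrite -[_ @^-1` _]setTI; exact: measurable_funP.
have fP : P (X i @^-1` A) = (fine (P (X i @^-1` A)))%:E.
  by rewrite fineK // fin_num_measure //; exact: mX.
have p0 : 0 <= fine (P (X i @^-1` A)) by rewrite fine_ge0.
pose m1 := mrestr P (mX i A mA).
pose m2 := mscale (NngNum p0) P.
rewrite -[LHS]/(m1 E) muleC fP -[RHS]/(m2 E).
apply: (@g_sigma_algebra_measure_unique _ _ _ G _ (fun=> setT)) => //.
- move=> _ [B /= mB <-]; apply: fin_bigcap_measurable; first exact: finite_finset.
  by move=> j _; exact: (mX j (B j)).
- by move=> _; exists (fun=> setT) => //=; rewrite bigcapT.
- by rewrite bigcup_const.
- move=> _ _ [B /= mB <-] [B' /= mB' <-]; exists (fun j => B j `&` B' j) => /=.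
    by move=> j; exact: measurableI.
  by rewrite -bigcapI; apply: eq_bigcapr => j _; rewrite preimage_setI.
- move=> _ [B /= mB <-]; rewrite /m1 /m2 /mrestr /mscale /= -fP.
  (* The cylinder and the condition on [X i] merge into one box over all coordinates, to which
     mutual independence applies. *)
  pose B' j := if j == i then A else B j.
  have mB' j : measurable (B' j) by rewrite /B'; case: eqP.
  have := indep [set: I]%SET B' mB'.
  have B'i : B' i = A by rewrite /B' eqxx.
  rewrite (bigD1 i) ?inE //= B'i => E1.
  transitivity (P (\bigcap_(j in [set` [set: I]%SET]) X j @^-1` B' j)).
    congr (P _); rewrite predeqE => w; split=> [[Bw Aw] j _|Bw].
      rewrite /B' /=; case: (eqVneq j i) => [->//|ji].
      by apply: Bw; rewrite /= !inE.
    split; last by have := Bw i; rewrite /B' /= eqxx; apply; rewrite inE.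
    move=> j /=; rewrite !inE => ji; have := Bw j; rewrite /B' /= (negPf ji).
    by apply; rewrite inE.
  rewrite E1; congr (_ * _)%E.
  rewrite (indep _ B mB); apply: eq_big => j; rewrite !inE // => ji.
  by rewrite /B' (negPf ji).
- move=> k; have mXA := mX i A mA; rewrite -[ltLHS]/(P (setT `&` X i @^-1` A)).
  by rewrite setTI (le_lt_trans (probability_le1 P mXA)) ?ltry.
Qed.

Definition upd (R : realType) (I : finType) (x : I -> R) (i : I) (t : R) :
  I -> R := fun j => if j == i then t else x j.

(** Intercept and slope are expressed by values of [f], so they inherit affinity and dependence
    properties from it. *)
Definition affine_in_each (R : realType) (I : finType) (f : (I -> R) -> R) :=
  forall x i t,
    f (upd x i t) = f (upd x i 0) + t * (f (upd x i 1) - f (upd x i 0)).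

(** The list [s] drives the inductions below: it holds the coordinates that are not yet frozen. *)
Definition depends_on (R : realType) (I : finType) (s : seq I)
    (f : (I -> R) -> R) :=
  forall x y, {in s, x =1 y} -> f x = f y.

Lemma upd_id (R : realType) (I : finType) (x : I -> R) (i : I) :
  upd x i (x i) = x.
Proof. by apply/funext => j; rewrite /upd; case: eqP => [->|]. Qed.

Lemma affine_in_each_upd (R : realType) (I : finType) (f : (I -> R) -> R)
    (i : I) (c : R) :
  affine_in_each f -> affine_in_each (fun x => f (upd x i c)).
Proof.
move=> af x j t; have [->|ji] := eqVneq j i.
  have updK s : upd (upd x i s) i c = upd x i c.
    by apply/funext => l; rewrite /upd; case: eqP.
  by rewrite !updK subrr mulr0 addr0.
have updC s : upd (upd x j s) i c = upd (upd x i c) j s.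
  apply/funext => l; rewrite /upd; case: (eqVneq l i) => // ->.
  by rewrite eq_sym (negPf ji).
by rewrite !updC.
Qed.

Lemma affine_in_eachB (R : realType) (I : finType) (f g : (I -> R) -> R) :
  affine_in_each f -> affine_in_each g -> affine_in_each (fun x => f x - g x).
Proof. by move=> af ag x i t; rewrite (af x i t) (ag x i t); ring. Qed.

Lemma depends_on_upd (R : realType) (I : finType) (s : seq I)
    (f : (I -> R) -> R) (i : I) (c : R) :
  depends_on (i :: s) f -> depends_on s (fun x => f (upd x i c)).
Proof.
move=> fs x y xy; apply: fs => j; rewrite inE /upd.
by case: eqP => //= _ /xy.
Qed.

Lemma depends_onB (R : realType) (I : finType) (s : seq I)
    (f g : (I -> R) -> R) :
  depends_on s f -> depends_on s g -> depends_on s (fun x => f x - g x).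
Proof. by move=> fs gs x y xy; rewrite (fs x y) // (gs x y). Qed.

Lemma affine_in_eachE (R : realType) (I : finType) (f : (I -> R) -> R)
    (x : I -> R) (i : I) :
  affine_in_each f ->
  f x = f (upd x i 0) + x i * (f (upd x i 1) - f (upd x i 0)).
Proof. by move=> af; rewrite -{1}(upd_id x i) af. Qed.

(** The measurable structure on [T] is left general because the lemma serves both for the ambient
    one and for the one generated by the coordinates other than a given one. *)
Lemma measurable_affine_in_each (R : realType) (I : finType) (s : seq I)
    (f : (I -> R) -> R) (d : measure_display) (T : measurableType d)
    (Y : I -> T -> R) :
  affine_in_each f -> depends_on s f ->
  (forall j, j \in s -> measurable_fun setT (Y j)) ->
  measurable_fun setT (fun w => f (Y ^~ w)).
Proof.
elim: s f => [|i s IH] f af fs mY.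
  rewrite (_ : (fun w => _) = cst (f (fun=> 0))); first exact: measurable_cst.
  by apply/funext => w /=; exact: fs.
have mYs j : j \in s -> measurable_fun setT (Y j).
  by move=> js; apply: mY; rewrite inE js orbT.
have mf c : measurable_fun setT (fun w => f (upd (Y ^~ w) i c)).
  apply: (IH (fun x => f (upd x i c))) => //; first exact: affine_in_each_upd.
  exact: depends_on_upd.
rewrite (_ : (fun w => _) = (fun w => f (upd (Y ^~ w) i 0) +
    Y i w * (f (upd (Y ^~ w) i 1) - f (upd (Y ^~ w) i 0)))).
  apply: measurable_funD => //; apply: measurable_funM.
    by apply: mY; rewrite mem_head.
  exact: measurable_funB.
by apply/funext => w; exact: affine_in_eachE.
Qed.

(** Induction on [s], writing [f] as [a + x i * b] with [a] and [b] depending on the tail. If [b]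
    vanishes identically, then [f] is [a]. Otherwise [b] is almost surely nonzero by induction, and
    there [f = 0] forces [X i] to equal [- a / b], a function of the other coordinates. *)
Lemma affine_in_each_null (R : realType) (d : measure_display)
    (T : measurableType d) (P : probability T R) (I : finType)
    (X : I -> {RV P >-> R}) (s : seq I) (f : (I -> R) -> R) :
  mutually_independent X ->
  (forall i x, P (X i @^-1` [set x]) = 0) ->
  uniq s -> affine_in_each f -> depends_on s f -> (exists x, f x != 0) ->
  P [set w | f (fun i => X i w) = 0] = 0.
Proof.
move=> indep atomless; elim: s f => [|i s IH] f.
  move=> _ _ fs [x fx]; rewrite (_ : [set w | _] = set0) ?measure0 //.
  rewrite -subset0 => w /= fw; move: fx.
  by rewrite (fs x (fun i => X i w)) ?fw ?eqxx.
move=> /andP[/= i_s us] af fs [x fx].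
pose a y := f (upd y i 0); pose b y := f (upd y i 1) - a y.
have aa : affine_in_each a by exact: affine_in_each_upd.
have as_ : depends_on s a by exact: depends_on_upd.
have ab : affine_in_each b.
  by apply: affine_in_eachB => //; exact: affine_in_each_upd.
have bs : depends_on s b.
  by apply: depends_onB => //; exact: depends_on_upd.
have fE y : f y = a y + y i * b y by exact: affine_in_eachE.
have mX j : measurable_fun setT (X j) by exact: measurable_funP.
have mf (g : (I -> R) -> R) t : affine_in_each g -> depends_on t g ->
    measurable_fun setT (fun w => g (fun j => X j w)).
  by move=> ag gt; apply: (measurable_affine_in_each ag gt).
have [[y by0]|nb] := pselect (exists y, b y != 0); last first.
  have b0 y : b y = 0.
    by apply/eqP/negPn/negP => by0; apply: nb; exists y.
  rewrite (_ : [set w | _] = [set w | a (fun i => X i w) = 0]).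
    by apply: IH => //; exists x; move: fx; rewrite fE b0 mulr0 addr0.
  by apply/seteqP; split=> w /=; rewrite fE b0 mulr0 addr0.
pose G := [set \bigcap_(j in [set` [set~ i]%SET]) X j @^-1` B j
      | B in [set B | forall j, measurable (B j)]].
have mXG j : j \in s ->
    measurable_fun (setT : set (g_sigma_algebraType G)) (X j : _ -> R).
  move=> js _ B mB; rewrite setTI; apply: sub_sigma_algebra.
  (* This cylinder constrains [X j] alone; it is admissible because [i_s] gives [j != i]. *)
  exists (fun l => if l == j then B else setT) => /=.
    by move=> l; case: eqP.
  apply/seteqP; split=> w /=.
    move=> /(_ j); rewrite eqxx; apply.
    by rewrite /= !inE; apply: contraNneq i_s => <-.
  by move=> Bw l _ /=; case: eqP => [->|].
have mYG : measurable_fun (setT : set (g_sigma_algebraType G))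
    (fun w => (a (fun j => X j w), b (fun j => X j w))).
  apply: measurable_fun_pair.
    exact: (@measurable_affine_in_each _ _ _ _ _ _ _ aa as_).
  exact: (@measurable_affine_in_each _ _ _ _ _ _ _ ab bs).
have mY : measurable_fun (setT : set T)
    (fun w => (a (fun j => X j w), b (fun j => X j w))).
  by apply: measurable_fun_pair; [exact: (mf _ _ aa as_) | exact: (mf _ _ ab bs)].
pose Y : {mfun T >-> (R * R)%type} := mfun_Sub (mem_set mY).
(* A point of [D] consists of the pair of values of [a] and [b], followed by the value of [X i]. *)
pose D := [set p : (R * R) * R | (p.1.2 != 0) && (p.1.1 + p.2 * p.1.2 == 0)].
have mD : measurable D.
  have m12 : measurable_fun setT (fun p : (R * R) * R => p.1.2).
    exact: measurableT_comp.
  have m11 : measurable_fun setT (fun p : (R * R) * R => p.1.1).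
    exact: measurableT_comp.
  rewrite -[D]setTI.
  apply: (@measurable_and _ _ _ _ _ _ _ measurableT [set true]) => //.
    apply: measurable_neg; exact: measurable_fun_eqr.
  apply: measurable_fun_eqr => //; apply: measurable_funD => //.
  exact: measurable_funM.
have YD0 : P ((fun w => (Y w, X i w)) @^-1` D) = 0.
  apply: independent_graph_null => //.
    move=> A B mA mB; apply: mutually_independent_system => //.
    by have := mYG measurableT A mA; rewrite setTI.
  (* The section at [(u, v)] is empty if [v = 0] and is the single point [- u / v] otherwise. *)
  move=> [u v]; rewrite /xsection.
  have [v0|v0] := eqVneq v 0.
    rewrite (_ : _ @^-1` _ = set0) ?measure0 // -subset0 => w /=.
    by rewrite /D inE /= v0 eqxx.
  rewrite (_ : _ @^-1` _ = X i @^-1` [set - u / v]) ?atomless //.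
  apply/seteqP; split=> w /=; rewrite /D inE /= v0 /=.
    by move=> /eqP uv; apply: (mulIf v0); rewrite mulfVK //; lra.
  by move=> ->; rewrite mulfVK // subrr.
have mb0 : measurable [set w | b (fun i => X i w) = 0].
  rewrite -[X in measurable X]setTI.
  exact: (mf _ _ ab bs measurableT [set 0] (measurable_set1 0)).
have mf0 : measurable [set w | f (fun i => X i w) = 0].
  rewrite -[X in measurable X]setTI.
  exact: (mf _ _ af fs measurableT [set 0] (measurable_set1 0)).
have mYD : measurable ((fun w => (Y w, X i w)) @^-1` D).
  rewrite -[X in measurable X]setTI.
  exact: (measurable_fun_pair mY (mX i)).
(* The zeros of [f] are covered by those of [b], null by induction, and the preimage of [D]. *)
apply: (subset_measure0 mf0 (measurableU _ _ mb0 mYD)).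
  move=> w /= fw; have [b0|b0] := eqVneq (b (fun j => X j w)) 0; first by left.
  by right; rewrite /D /= b0 /= -fw fE.
apply: etrans (measureU0 mb0 mYD YD0) _.
by apply: IH => //; exists y.
Qed.

(** * Almost sure nonsingularity of a Gaussian sketch *)

(** Entry [(i, j)] affects only column [j] of the product, and does so affinely. The transpose [N]
    turns this column into a row, for multilinearity in rows. *)
Lemma affine_in_each_det (R : realType) (m k : nat) (A : 'M[R]_(k, m)) :
  affine_in_each (fun x : 'I_m * 'I_k -> R =>
    \det (A *m \matrix_(i, j) x (i, j))).
Proof.
move=> x [i j] t; pose N s := (A *m \matrix_(p, q) upd x (i, j) s (p, q))^T.
have detN s : \det (A *m \matrix_(p, q) upd x (i, j) s (p, q)) = \det (N s).
  by rewrite det_tr.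
rewrite !detN.
have rowN s : row' j (N s) = row' j (N t).
  apply/matrixP => p q; rewrite !mxE; apply: eq_bigr => l _.
  by rewrite !mxE /upd !xpair_eqE ![_ == j]eq_sym (negPf (neq_lift _ _)) andbF.
suff -> : \det (N t) = (1 - t) * \det (N 0) + t * \det (N 1) by ring.
apply: (determinant_multilinear (i0 := j)) => //.
apply/rowP => q; rewrite !mxE !mulr_sumr -big_split; apply: eq_bigr => l _ /=.
by rewrite !mxE /upd; case: eqP => _; ring.
Qed.

(** The normal law is absolutely continuous with respect to Lebesgue measure, for which points are
    null. *)
Lemma gaussian_atomless (R : realType) (d : measure_display)
    (T : measurableType d) (P : probability T R) (m k : nat)
    (X : 'I_m -> 'I_k -> {RV P >-> R}) (i : 'I_m) (j : 'I_k) (x : R) :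
  standard_gaussian_entries X -> P (X i j @^-1` [set x]) = 0.
Proof.
move=> [normalX _]; rewrite -[LHS]/(distribution P (X i j) [set x]).
rewrite normalX; last exact: measurable_set1.
have := @normal_prob_dominates R 0 1.
move=> /null_content_dominatesP; apply => //.
exact: lebesgue_measure_set1.
Qed.

Lemma gaussian_sketch_unitmx (R : realType) (d : measure_display)
    (T : measurableType d) (P : probability T R) (m k : nat)
    (X : 'I_m -> 'I_k -> {RV P >-> R}) (A : 'M[R]_(k, m)) :
  standard_gaussian_entries X -> A *m A^T = 1%:M ->
  P [set w | \det (A *m random_matrix X w) = 0] = 0.
Proof.
move=> gX AA; have [_ indep] := gX.
apply: (affine_in_each_null indep (s := enum {: 'I_m * 'I_k})
  (f := fun x => \det (A *m \matrix_(i, j) x (i, j)))).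
- by move=> [i j] x; exact: gaussian_atomless.
- exact: enum_uniq.
- exact: affine_in_each_det.
- move=> x y xy; congr (\det (A *m _)); apply/matrixP => i j.
  by rewrite !mxE xy ?mem_enum.
(* At the matrix [A^T] the determinant is 1, so the function is not identically zero. *)
exists (fun ij => A^T ij.1 ij.2).
rewrite (_ : \matrix_(i, j) _ = A^T); last by apply/matrixP => i j; rewrite mxE.
by rewrite AA det1 oner_neq0.
Qed.

(** * Measurability of the event and conclusion *)

Lemma rational_vector_approx (R : realType) (n : nat) (x : 'cV[R]_n) (e : R) :
  0 < e -> exists q : 'cV[rat]_n, euclidean_norm (x - map_mx ratr q) <= e.
Proof.
(* The divisor [n.+1] is nonzero even for [n = 0], and [n] squares of [h] sum to at most
   [(h * n.+1) ^+ 2 = e ^+ 2]. *)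
move=> e0; pose h := e / n.+1%:R.
have h0 : 0 < h by rewrite divr_gt0 ?ltr0n.
have /choice[q qh] : forall i, exists r : rat, `|x i 0 - ratr r| <= h.
  move=> i; have : x i 0 - h < x i 0 + h by lra.
  move=> /rat_in_itvoo[r]; rewrite in_itv /= => /andP[rl ru].
  by exists r; rewrite ler_norml; apply/andP; split; lra.
exists (\col_i q i); apply: euclidean_norm_le; first exact: ltW.
rewrite dotE (@le_trans _ _ (\sum_(i < n) h ^+ 2)) //.
  apply: ler_sum => i _; rewrite !mxE -expr2 -[leLHS]real_normK ?num_real //.
  by rewrite ler_pXn2r ?nnegrE // ltW.
have -> : e = h * n.+1%:R by rewrite divfK ?pnatr_eq0.
rewrite sumr_const card_ord [leRHS]exprMn.
rewrite -[leLHS]mulr_natr ler_wpM2l ?sqr_ge0 // -natrX ler_nat.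
by rewrite (leq_trans (leqnSn n)) // -{1}[n.+1]expn1 leq_pexp2l.
Qed.

(** This trades an uncountable supremum for countably many inequalities polynomial in the entries of
    [A], hence measurable conditions. Density of the rational vectors gives the converse. *)
Lemma sqr_spectral_norm_leP (R : realType) (m n : nat) (A : 'M[R]_(m, n))
    (c : R) :
  0 <= c -> spectral_norm A ^+ 2 <= c <->
  forall q : 'cV[rat]_n,
    dot (A *m map_mx ratr q) (A *m map_mx ratr q)
      <= c * dot (map_mx ratr q) (map_mx ratr q).
Proof.
move=> c0; split=> [Ac q|Ac].
  set x : 'cV[R]_n := map_mx ratr q.
  rewrite -!sqr_euclidean_norm.
  apply: (@le_trans _ _ ((spectral_norm A * euclidean_norm x) ^+ 2)).
    rewrite ler_pXn2r ?nnegrE ?mulr_ge0 ?spectral_norm_ge0 ?euclidean_norm_ge0 //.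
    exact: euclidean_norm_mulmx.
  by rewrite exprMn ler_wpM2r ?sqr_ge0.
set s := Num.sqrt c; have s0 : 0 <= s by exact: sqrtr_ge0.
rewrite -(sqr_sqrtr c0) ler_pXn2r ?nnegrE ?spectral_norm_ge0 //.
apply: spectral_norm_le => // x; apply/ler_addgt0Pr => e e0.
set a := spectral_norm A; have a0 : 0 <= a by exact: spectral_norm_ge0.
(* Replacing [x] by [y] costs [a] times their distance through [A] and [s] times it through the norm
   of [y]; the added 1 keeps the divisor positive. *)
have sa0 : 0 < s + a + 1 by rewrite ltr_wpDl ?addr_ge0.
have [q] := rational_vector_approx x (divr_gt0 e0 sa0).
set y := map_mx ratr q; rewrite ler_pdivlMr // => xy.
have Ay : euclidean_norm (A *m y) <= s * euclidean_norm y.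
  rewrite -(@ler_pXn2r _ 2) ?nnegrE ?mulr_ge0 ?euclidean_norm_ge0 //.
  by rewrite exprMn !sqr_euclidean_norm sqr_sqrtr //; exact: Ac.
have := euclidean_normD (A *m y) (A *m (x - y)).
rewrite -mulmxDr addrC subrK => Ax.
have Axy := euclidean_norm_mulmx A (x - y).
have := euclidean_normD x (- (x - y)).
rewrite euclidean_normN opprB addrC subrK => /(ler_wpM2l s0) yx.
have := euclidean_norm_ge0 (x - y); move: Axy; rewrite -/a -/s; lra.
Qed.

Lemma measurable_spectral_norm_le (R : realType) (d : measure_display)
    (T : measurableType d) (m n : nat) (B : T -> 'M[R]_(m, n)) (c : T -> R) :
  (forall i j, measurable_fun setT (fun w => B w i j)) ->
  measurable_fun setT c -> (forall w, 0 <= c w) ->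
  measurable [set w | spectral_norm (B w) ^+ 2 <= c w].
Proof.
move=> mB mc c0.
pose F (q : 'cV[rat]_n) := let x := map_mx ratr q in
  [set w | dot (B w *m x) (B w *m x) <= c w * dot x x].
(* Rational vectors are enumerated by their codes; a number that codes no vector imposes no
   condition. *)
pose H N := if unpickle N is Some q then F q else setT.
rewrite (_ : [set w | _] = \bigcap_N H N).
  apply: bigcapT_measurable => N; rewrite /H; case: unpickle => // q.
  rewrite -[F q]setTI.
  apply: (measurable_fun_ler _ _ measurableT (Y := [set true])) => //; last first.
    exact: measurable_funM.
  under eq_fun do rewrite dotE.
  apply: measurable_sum => i.
  have mBq : measurable_fun setT (fun w => (B w *m map_mx ratr q) i 0).
    under eq_fun do rewrite mxE.
    by apply: measurable_sum => j; exact: measurable_funM.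
  exact: measurable_funM.
apply/seteqP; split=> w /=.
  move=> /(sqr_spectral_norm_leP _ (c0 w)) Bw N _; rewrite /H.
  by case: unpickle => // q; exact: Bw.
move=> Hw; apply/(sqr_spectral_norm_leP _ (c0 w)) => q.
by have := Hw (pickle q) I; rewrite /H pickleK.
Qed.

Lemma measurable_mulmx (R : realType) (d : measure_display)
    (T : measurableType d) (m n p : nat) (A : T -> 'M[R]_(m, n))
    (B : T -> 'M[R]_(n, p)) :
  (forall i j, measurable_fun setT (fun w => A w i j)) ->
  (forall i j, measurable_fun setT (fun w => B w i j)) ->
  forall i j, measurable_fun setT (fun w => (A w *m B w) i j).
Proof.
move=> mA mB i j; under eq_fun do rewrite mxE.
by apply: measurable_sum => l; exact: measurable_funM.
Qed.

Lemma measurable_det (R : realType) (d : measure_display)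
    (T : measurableType d) (n : nat) (A : T -> 'M[R]_n) :
  (forall i j, measurable_fun setT (fun w => A w i j)) ->
  measurable_fun setT (fun w => \det (A w)).
Proof.
move=> mA; apply: measurable_sum => s; apply: measurable_funM => //.
exact: measurable_prod.
Qed.

Lemma measurable_adjugate (R : realType) (d : measure_display)
    (T : measurableType d) (n : nat) (A : T -> 'M[R]_n) :
  (forall i j, measurable_fun setT (fun w => A w i j)) ->
  forall i j, measurable_fun setT (fun w => (\adj (A w)) i j).
Proof.
move=> mA i j; under eq_fun do rewrite mxE.
apply: measurable_funM => //; apply: measurable_det => p q.
by under eq_fun do rewrite !mxE; exact: mA.
Qed.

Lemma spectral_normZ (R : realType) (m n : nat) (c : R) (A : 'M[R]_(m, n)) :
  spectral_norm (c *: A) = `|c| * spectral_norm A.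
Proof.
have le b (B : 'M[R]_(m, n)) : spectral_norm (b *: B) <= `|b| * spectral_norm B.
  apply: spectral_norm_le => [|x]; first by rewrite mulr_ge0 ?spectral_norm_ge0.
  rewrite -scalemxAl euclidean_normZ -mulrA ler_wpM2l //.
  exact: euclidean_norm_mulmx.
apply/eqP; rewrite eq_le le /=; have [->|c0] := eqVneq c 0.
  by rewrite normr0 mul0r spectral_norm_ge0.
(* The reverse inequality is [le] for the scalar inverse of [c], applied to [c *: A]. *)
rewrite -ler_pdivlMl ?normr_gt0 // -normfV.
by rewrite -{1}[A](scalerK c0) le.
Qed.

(* Clearing the denominator of [invmx] keeps every quantity polynomial in the
   entries: where [Z w] is singular [invmx] is [Z w] itself. *)
Lemma measurable_sketch_event (R : realType) (d : measure_display)
    (T : measurableType d) (r k : nat) (S : 'M[R]_r) (W : T -> 'M[R]_(r, k))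
    (Z : T -> 'M[R]_k) (c : R) :
  0 <= c -> (forall i j, measurable_fun setT (fun w => W w i j)) ->
  (forall i j, measurable_fun setT (fun w => Z w i j)) ->
  measurable [set w | spectral_norm (S *m (W w *m invmx (Z w))) ^+ 2 <= c].
Proof.
move=> c0 mW mZ; have mdet := measurable_det mZ.
have mS i j : measurable_fun [set: T] (fun=> S i j) by exact: measurable_cst.
have m0 : measurable [set w | \det (Z w) = 0].
  have := mdet measurableT [set 0] (measurable_set1 0).
  by rewrite setTI.
pose A1 := [set w | spectral_norm (S *m (W w *m Z w)) ^+ 2 <= c].
pose A2 := [set w | spectral_norm (S *m (W w *m \adj (Z w))) ^+ 2
  <= c * \det (Z w) ^+ 2].
have mA1 : measurable A1.
  apply: measurable_spectral_norm_le => //.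
  by apply: measurable_mulmx => //; exact: measurable_mulmx.
have mA2 : measurable A2.
  apply: measurable_spectral_norm_le => //.
  - apply: measurable_mulmx => //; apply: measurable_mulmx => //.
    exact: measurable_adjugate.
  - by apply: measurable_funM => //; exact: measurable_funX.
  - by move=> w; rewrite mulr_ge0 ?sqr_ge0.
rewrite (_ : [set w | _] = ([set w | \det (Z w) = 0] `&` A1)
    `|` (~` [set w | \det (Z w) = 0] `&` A2)).
  by apply: measurableU; apply: measurableI => //; exact: measurableC.
have invE w : \det (Z w) != 0 ->
    (spectral_norm (S *m (W w *m invmx (Z w))) ^+ 2 <= c) =
    (spectral_norm (S *m (W w *m \adj (Z w))) ^+ 2 <= c * \det (Z w) ^+ 2).
  move=> Zw; rewrite /invmx unitmxE unitfE Zw.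
  rewrite -!scalemxAr spectral_normZ exprMn real_normK ?num_real //.
  by rewrite exprVn ler_pdivrMl ?exprn_even_gt0 // [c * _]mulrC.
have sing w : \det (Z w) = 0 -> invmx (Z w) = Z w.
  by move=> Zw; rewrite /invmx unitmxE unitfE Zw eqxx.
apply/seteqP; split=> w /=.
  have [Zw|Zw] := eqVneq (\det (Z w)) 0.
    by rewrite sing //; left.
  by rewrite invE // => ?; right; split => //; exact/eqP.
by case=> [[Zw A1w]|[/eqP Zw A2w]]; [rewrite sing | rewrite invE].
Qed.

(** * Conditional expectation and the final estimate *)

(** The integral of a nonnegative function is the supremum over the simple functions below it, and
    those below [f] are also below [g]. *)
Lemma ge0_le_integral_nonmeasurable (R : realType) (d : measure_display)
    (T : measurableType d) (mu : {measure set T -> \bar R}) (D : set T)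
    (f g : T -> \bar R) :
  (forall x, D x -> 0 <= f x)%E -> (forall x, D x -> f x <= g x)%E ->
  (\int[mu]_(x in D) f x <= \int[mu]_(x in D) g x)%E.
Proof.
move=> f0 fg; rewrite !ge0_integralE //; last first.
  by move=> x Dx; exact: le_trans (f0 x Dx) (fg x Dx).
apply: le_ereal_sup => _ [h /= hf <-]; exists h => //= x.
apply: (le_trans (hf x)); rewrite !patchE.
by case: ifPn => // /set_mem; exact: fg.
Qed.

(* [X] is only compared with a measurable majorant that is infinite on the
   null set [N], so its measurability is never needed. *)
Lemma cond_expectation_le (R : realType) (d : measure_display)
    (T : measurableType d) (P : probability T R) (A N : set T) (X : T -> R)
    (c : R) :
  measurable A -> measurable N -> P N = 0 -> 0 <= c -> (forall w, 0 <= X w) ->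
  (forall w, A w -> ~ N w -> X w <= c) ->
  (cond_expectation P A X <= c%:E)%E.
Proof.
move=> mA mN N0 c0 X0 Xc; rewrite /cond_expectation.
have PA0 : 0 <= fine (P A) by rewrite fine_ge0.
have PAE : P A = (fine (P A))%:E by rewrite fineK // fin_num_measure.
suff XA : (\int[P]_(w in A) (X w)%:E <= c%:E * P A)%E.
  apply: (@le_trans _ _ ((fine (P A))^-1%:E * (c%:E * P A))%E).
    by rewrite lee_wpmul2l // lee_fin invr_ge0.
  (* When [A] is null, the convention that the inverse of 0 is 0 makes the left side 0. *)
  rewrite PAE -!EFinM lee_fin; have [->|PA] := eqVneq (fine (P A)) 0.
    by rewrite invr0 mul0r.
  by rewrite mulrCA mulVf // mulr1.
pose g w := (if w \in N then +oo else c%:E)%E.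
have g0 w : (0 <= g w)%E by rewrite /g; case: ifP; rewrite ?leey ?lee_fin.
have mg : measurable_fun A g.
  apply: measurable_funTS; apply: measurable_fun_ifT => //.
  apply: (measurable_fun_bool true); rewrite setTI.
  rewrite (_ : _ @^-1` _ = N) //; apply/seteqP.
  by split=> w /=; [move=> /set_mem | move=> /mem_set].
apply: (@le_trans _ _ (\int[P]_(w in A) g w)%E).
  apply: ge0_le_integral_nonmeasurable => w Aw; first by rewrite lee_fin.
  rewrite /g; case: ifPn => [_|/negP wN]; first by rewrite leey.
  by rewrite lee_fin; apply: Xc => // /mem_set.
rewrite (ge0_negligible_integral mN) //.
rewrite (eq_integral (cst c%:E)); last first.
  by move=> w /set_mem[_ /= wN]; rewrite /g ifN //; apply/negP => /set_mem.
rewrite integral_cst; last exact: measurableD.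
by rewrite lee_wpmul2l ?lee_fin // le_measure ?inE //; exact: measurableD.
Qed.

Theorem theorem3p1 (R : realType) (p m k : nat)
    (p_gt0 : (0 < p)%N) (pm : (p <= m)%N) (k_gt0 : (0 < k)%N) (km : (k < m)%N)
    (E : 'M[R]_p) (C : 'M[R]_(p, m))
    (E_spd : sym_posdef E) (C_full : \rank C = p)
    (U : 'M[R]_m) (lam : 'rV[R]_m)
    (eigD : ordered_eigendecomposition (DeltaE E C) U lam)
    (lamk_neq0 : lam 0 (kth_ord km) != 0)
    (d : measure_display) (T : measurableType d) (P : probability T R)
    (X : 'I_m -> 'I_k -> {RV P >-> R}) (X_gauss : standard_gaussian_entries X) :
  let Omega := random_matrix X in
  let Delta := DeltaE E C in
  let lamk := `|lam 0 (kth_ord km)| in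
  let Lam2 := trailing_diag km lam in
  let sqrtLam2 := trailing_sqrt_abs km lam in
  let Psi := [set w : T |
    spectral_norm (sqrtLam2 *m sketch_ratio km U (Omega w)) ^+ 2
      <= 2^-1 * lamk] in
  let err := fun w : T => Delta - sketch_approx Delta (Omega w) in
  (cond_expectation P Psi (fun w => spectral_norm (err w))
     <= (lamk + 2 * Num.sqrt 2 * spectral_norm sqrtLam2 * Num.sqrt lamk
         + 2 * spectral_norm Lam2)%:E)%E.
Proof.
cbv zeta; set Omega := random_matrix X.
have [UU _ _] := eigD.
have mOmega r (A : 'M[R]_(r, m)) i j :
    measurable_fun setT (fun w => (A *m Omega w) i j).
  apply: measurable_mulmx => [p1 q1|p1 q1]; first exact: measurable_cst.
  by under eq_fun do rewrite mxE; exact: measurable_funP.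
pose U1 := colsub (lead_ord km) U.
have U1U1 : U1^T *m U1 = 1%:M.
  by apply: colsub_isometry => //; exact: lead_ord_inj.
(* On this set [sketch_ratio] takes a meaningless value, and the pointwise bound is claimed only
   outside it. *)
pose N := [set w | \det (U1^T *m Omega w) = 0].
have mN : measurable N.
  have := measurable_det (mOmega _ U1^T) measurableT (measurable_set1 0).
  by rewrite setTI.
apply: (@cond_expectation_le _ _ _ _ _ N) => //.
- by apply: measurable_sketch_event; rewrite ?mulr_ge0.
- by apply: gaussian_sketch_unitmx => //; rewrite trmxK.
- by rewrite !addr_ge0 ?mulr_ge0 ?spectral_norm_ge0 ?sqrtr_ge0 ?normr_ge0.
- by move=> w; exact: spectral_norm_ge0.
move=> w Psiw /eqP Nw.
have Zu : U1^T *m Omega w \in unitmx by rewrite unitmxE unitfE.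
exact: conditional_error_bound eigD lamk_neq0 Zu Psiw.
Qed.
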